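(* For every $n\ge2$, $\mathrm{Out}(K_n)\cong\mathbb{Z}_2^{\,n}$.
   Context: $\mathrm{E}(n)=\mathrm{O}(n)\ltimes\mathbb{R}^n$ is the group of rigid motions of $\mathbb{R}^n$, with product $(B,b)(C,c)=(BC,Bc+b)$. Let $e_1,\dots,e_n$ be the canonical basis of $\mathbb{Z}^n$, and let $C_i=\mathrm{diag}(1,\dots,1,-1,1,\dots,1)$ be the $n\times n$ diagonal matrix with $-1$ in position $(i,i)$ and $1$ elsewhere on the diagonal. $K_n$ is the subgroup of $\mathrm{E}(n)$ generated by $(Id,e_1)$ and the elements $(C_i,\tfrac12e_{i+1})$ for $1\le i\le n-1$. $\mathrm{Out}(K_n)=\mathrm{Aut}(K_n)/\mathrm{Inn}(K_n)$. *)

(* Defs.v *)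
From HB Require Import structures.
From mathcomp Require Import all_boot all_order all_algebra.
From mathcomp Require Import boolp classical_sets reals.
Set Implicit Arguments.
Unset Strict Implicit.
Unset Printing Implicit Defensive.
Import GRing.Theory.

Local Open Scope classical_set_scope.
Local Open Scope group_scope.

Definition isomorphic (G H : groupType) : Prop :=
  exists f : {multiplicative G -> H}, bijective f.

Definition subgroup (G : groupType) (H : set G) : Prop :=
  [/\ H 1, forall x y, H x -> H y -> H (x * y) & forall x, H x -> H x^-1].

Definition normal_subgroup (G : groupType) (N : set G) : Prop :=
  subgroup N /\ forall x y, N x -> N (x ^ y).

Section Generated.
Variables (G : groupType) (S : set G).

Definition generated : set G :=
  [set x | forall H : set G, subgroup H -> S `<=` H -> H x].

Lemma subgroup_generated : subgroup generated.
Proof.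
split=> [H [] //|x y hx hy H sH SH|x hx H sH SH].
  by have [_ hM _] := sH; apply: hM; [exact: hx|exact: hy].
by have [_ _ hV] := sH; apply: hV; exact: hx.
Qed.

Definition in_generated : pred G := fun x => x \in generated.

Record generated_group :=
  GeneratedGroup { gen_val :> G; _ : in_generated gen_val }.

HB.instance Definition _ := [isSub of generated_group for gen_val].
HB.instance Definition _ := [Choice of generated_group by <:].

Lemma in_generated_group_closed : group_closed in_generated.
Proof.
have [h1 hM hV] := subgroup_generated.
split=> [|x y]; rewrite !unfold_in ?inE // => hx hy.
by apply: hM => //; exact: hV.
Qed.

HB.instance Definition _ :=
  SubChoice_isSubGroup.Build G in_generated generated_group
    in_generated_group_closed.

End Generated.

(* G / N; the law and the inverse are chosen so that \pi is a morphism, see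
   [quotient_piM] and [quotient_piV] *)
Section Quotient.
Local Open Scope quotient_scope.
Variables (G : groupType) (N : set G) (nN : normal_subgroup N).

Definition coset_rel (x y : G) : bool := `[< N (x^-1 * y) >].

Lemma coset_rel_refl : reflexive coset_rel.
Proof. by move=> x; apply/asboolP; rewrite mulVg; have [[]] := nN. Qed.

Lemma coset_rel_sym : symmetric coset_rel.
Proof.
have [[_ _ hV] _] := nN.
suff h x y : coset_rel x y -> coset_rel y x by move=> x y; apply/idP/idP; exact: h.
by move=> /asboolP/hV; rewrite invgM invgK => ?; apply/asboolP.
Qed.

Lemma coset_rel_trans : transitive coset_rel.
Proof.
have [[_ hM _] _] := nN.
move=> y x z /asboolP hxy /asboolP hyz; apply/asboolP.
by have := hM _ _ hxy hyz; rewrite mulgA mulgK.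
Qed.

Canonical coset_equiv :=
  EquivRel coset_rel coset_rel_refl coset_rel_sym coset_rel_trans.

Definition quotient_group := {eq_quot coset_equiv}.

HB.instance Definition _ := Choice.on quotient_group.
HB.instance Definition _ := EqQuotient.on quotient_group.

Definition quotient_mul (a b : quotient_group) : quotient_group :=
  \pi_quotient_group (repr a * repr b).
Definition quotient_one : quotient_group := \pi_quotient_group 1.
Definition quotient_inv (a : quotient_group) : quotient_group :=
  \pi_quotient_group (repr a)^-1.

Lemma quotient_piP (x y : G) :
  \pi_quotient_group x = \pi_quotient_group y <-> N (x^-1 * y).
Proof.
split=> [/eqmodP/asboolP//|h].
by apply/eqmodP/asboolP.
Qed.

Lemma quotient_reprP (x : G) : N (x^-1 * repr (\pi_quotient_group x)).
Proof. by apply/quotient_piP; rewrite reprK. Qed.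

Lemma quotient_piM (x y : G) :
  quotient_mul (\pi_quotient_group x) (\pi_quotient_group y) =
  \pi_quotient_group (x * y).
Proof.
have [[_ hM _] hJ] := nN.
apply/esym/quotient_piP.
have hx := quotient_reprP x; have hy := quotient_reprP y.
set a := repr _ in hx *; set b := repr _ in hy *.
have := hM _ _ (hJ _ y hx) hy.
by rewrite conjgE invgM !mulgA mulgK.
Qed.

Lemma quotient_piV (x : G) :
  quotient_inv (\pi_quotient_group x) = \pi_quotient_group x^-1.
Proof.
have [_ hJ] := nN.
apply/quotient_piP; rewrite invgK.
have := hJ _ x^-1 (quotient_reprP x).
by rewrite conjgE invgK !mulgA mulgV mul1g.
Qed.

Lemma quotient_mulA : associative quotient_mul.
Proof.
move=> a b c; rewrite -[a]reprK -[b]reprK -[c]reprK.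
move: (repr a) (repr b) (repr c) => x y z.
by rewrite (quotient_piM y z) (quotient_piM x y) !quotient_piM mulgA.
Qed.

Lemma quotient_mul1 : left_id quotient_one quotient_mul.
Proof. by move=> a; rewrite -[a]reprK [LHS]quotient_piM mul1g. Qed.

Lemma quotient_mulr1 : right_id quotient_one quotient_mul.
Proof. by move=> a; rewrite -[a]reprK [LHS]quotient_piM mulg1. Qed.

Lemma quotient_mulV : left_inverse quotient_one quotient_inv quotient_mul.
Proof.
by move=> a; rewrite -[a]reprK quotient_piV [LHS]quotient_piM mulVg.
Qed.

Lemma quotient_mulrV : right_inverse quotient_one quotient_inv quotient_mul.
Proof.
by move=> a; rewrite -[a]reprK quotient_piV [LHS]quotient_piM mulgV.
Qed.

HB.instance Definition _ := isGroup.Build quotient_group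
  quotient_mulA quotient_mul1 quotient_mulr1 quotient_mulV quotient_mulrV.

End Quotient.

Section Automorphisms.
Variable G : groupType.

Definition is_automorphism : pred (G -> G) :=
  fun f => `[< {morph f : x y / x * y} /\ bijective f >].

Record automorphism :=
  Automorphism { aut_fun :> G -> G; _ : is_automorphism aut_fun }.

HB.instance Definition _ := [isSub of automorphism for aut_fun].
HB.instance Definition _ := [Choice of automorphism by <:].

Lemma autM (f : automorphism) : {morph f : x y / x * y}.
Proof. by case: f => f /= /asboolP[]. Qed.

Lemma aut_bij (f : automorphism) : bijective f.
Proof. by case: f => f /= /asboolP[]. Qed.

Lemma aut_inv_exists (f : automorphism) :
  exists g : G -> G, cancel f g /\ cancel g f.
Proof. by have [g fK gK] := aut_bij f; exists g. Qed.

Definition aut_inv_fun (f : automorphism) : G -> G :=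
  projT1 (cid (aut_inv_exists f)).

Lemma aut_funK (f : automorphism) : cancel f (aut_inv_fun f).
Proof. by rewrite /aut_inv_fun; case: cid => g []. Qed.

Lemma aut_inv_funK (f : automorphism) : cancel (aut_inv_fun f) f.
Proof. by rewrite /aut_inv_fun; case: cid => g []. Qed.

Lemma aut_one_subproof : is_automorphism idfun.
Proof. by apply/asboolP; split=> //; exists idfun. Qed.

Lemma aut_mul_subproof (f g : automorphism) : is_automorphism (f \o g).
Proof.
apply/asboolP; split; last by apply: bij_comp; exact: aut_bij.
by move=> x y /=; rewrite !autM.
Qed.

Lemma aut_inv_subproof (f : automorphism) : is_automorphism (aut_inv_fun f).
Proof.
apply/asboolP; split.
  move=> x y; apply: (bij_inj (aut_bij f)).
  by rewrite autM !aut_inv_funK.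
by exists f; [exact: aut_inv_funK|exact: aut_funK].
Qed.

Definition aut_one := Automorphism aut_one_subproof.
Definition aut_mul f g := Automorphism (aut_mul_subproof f g).
Definition aut_inv f := Automorphism (aut_inv_subproof f).

Lemma aut_eqP (f g : automorphism) : f =1 g -> f = g.
Proof. by move=> fg; apply/val_inj/funext. Qed.

Lemma aut_mulA : associative aut_mul.
Proof. by move=> f g h; exact: aut_eqP. Qed.

Lemma aut_mul1 : left_id aut_one aut_mul.
Proof. by move=> f; exact: aut_eqP. Qed.

Lemma aut_mulr1 : right_id aut_one aut_mul.
Proof. by move=> f; exact: aut_eqP. Qed.

Lemma aut_mulV : left_inverse aut_one aut_inv aut_mul.
Proof. by move=> f; apply: aut_eqP => x /=; rewrite aut_funK. Qed.

Lemma aut_mulrV : right_inverse aut_one aut_inv aut_mul.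
Proof. by move=> f; apply: aut_eqP => x /=; rewrite aut_inv_funK. Qed.

HB.instance Definition _ :=
  isGroup.Build automorphism aut_mulA aut_mul1 aut_mulr1 aut_mulV aut_mulrV.

Lemma inner_subproof (g : G) : is_automorphism (fun x => g * x * g^-1).
Proof.
apply/asboolP; split=> [x y|]; first by rewrite !mulgA mulgVK.
exists (fun x => g^-1 * x * g) => x; first by rewrite !mulgA mulVg mul1g mulgVK.
by rewrite !mulgA mulgV mul1g mulgK.
Qed.

Definition inner (g : G) := Automorphism (inner_subproof g).

Definition Inn : set automorphism := range inner.

Lemma Inn_normal : normal_subgroup Inn.
Proof.
split; first split.
- exists 1 => //; apply: aut_eqP => x /=.
  by rewrite mul1g invg1 mulg1.
- move=> _ _ [g _ <-] [h _ <-]; exists (g * h) => //; apply: aut_eqP => x /=.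
  by rewrite invgM !mulgA.
- move=> _ [g _ <-]; exists g^-1 => //.
  apply/(mulgI (inner g)); rewrite mulgV; apply: aut_eqP => x /=.
  by rewrite invgK !mulgA mulgV mul1g mulgK.
- move=> _ f [g _ <-]; exists (aut_inv_fun f g) => //.
  apply/(mulgI f); rewrite conjgE mulgA mulgV mul1g; apply: aut_eqP => x /=.
  rewrite !autM aut_inv_funK; congr (_ * _).
  apply: (mulgI g); rewrite mulgV -{1}(aut_inv_funK f g) -autM mulgV.
  by apply: (mulgI (f 1)); rewrite -autM !mulg1.
Qed.

End Automorphisms.

Notation Aut := automorphism.

Definition Out (G : groupType) : groupType := quotient_group (@Inn_normal G).

Section RigidMotions.
Local Open Scope ring_scope.
Variables (R : realType) (n : nat).

Definition orthogonal : pred 'M[R]_n := fun B => B^T *m B == 1%:M.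

(* the pair (B, b) acts as x |-> B *m x + b *)
Record rigid_motion := RigidMotion {
  motion_pair :> 'M[R]_n * 'cV[R]_n;
  _ : orthogonal motion_pair.1 }.

HB.instance Definition _ := [isSub of rigid_motion for motion_pair].
HB.instance Definition _ := [Choice of rigid_motion by <:].

Lemma motion_orthogonal (u : rigid_motion) : orthogonal u.1.
Proof. by case: u. Qed.

Lemma orthogonal1 : orthogonal 1%:M.
Proof. by rewrite /orthogonal trmx1 mulmx1. Qed.

Lemma orthogonalM B C : orthogonal B -> orthogonal C -> orthogonal (B *m C).
Proof.
move=> /eqP hB /eqP hC; rewrite /orthogonal trmx_mul mulmxA -(mulmxA C^T) hB.
by rewrite mulmx1 hC.
Qed.

Lemma orthogonalT B : orthogonal B -> orthogonal B^T.
Proof. by move=> /eqP /mulmx1C hB; rewrite /orthogonal trmxK hB. Qed.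

Definition motion_one : rigid_motion :=
  @RigidMotion (1%:M, 0) orthogonal1.
Definition motion_mul (u v : rigid_motion) : rigid_motion :=
  @RigidMotion (u.1 *m v.1, u.1 *m v.2 + u.2)
    (orthogonalM (motion_orthogonal u) (motion_orthogonal v)).
Definition motion_inv (u : rigid_motion) : rigid_motion :=
  @RigidMotion (u.1^T, - (u.1^T *m u.2)) (orthogonalT (motion_orthogonal u)).

Lemma motion_mulA : associative motion_mul.
Proof.
move=> u v w; apply/val_inj/pair_equal_spec; split=> /=; rewrite ?mulmxA //.
by rewrite mulmxDr mulmxA addrA.
Qed.

Lemma motion_mul1 : left_id motion_one motion_mul.
Proof.
by move=> u; apply/val_inj; rewrite /= !mul1mx addr0; case: (motion_pair u).
Qed.

Lemma motion_mulr1 : right_id motion_one motion_mul.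
Proof.
by move=> u; apply/val_inj; rewrite /= mulmx1 mulmx0 add0r; case: (motion_pair u).
Qed.

Lemma motion_mulV : left_inverse motion_one motion_inv motion_mul.
Proof.
move=> u; apply/val_inj; rewrite /= subrr.
by rewrite (eqP (motion_orthogonal u)).
Qed.

Lemma motion_mulrV : right_inverse motion_one motion_inv motion_mul.
Proof.
move=> u; apply/val_inj; rewrite /= mulmxN mulmxA.
by rewrite (mulmx1C (eqP (motion_orthogonal u))) mul1mx addNr.
Qed.

HB.instance Definition _ := isGroup.Build rigid_motion
  motion_mulA motion_mul1 motion_mulr1 motion_mulV motion_mulrV.

(* 0-based: basis i is e_(i+1), reflection i is C_(i+1) *)
Definition basis (i : 'I_n) : 'cV[R]_n := delta_mx i 0.

Definition reflection (i : 'I_n) : 'M[R]_n :=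
  diag_mx (\row_j (if j == i then -1 else 1)).

Lemma reflection_orthogonal i : orthogonal (reflection i).
Proof.
rewrite /orthogonal tr_diag_mx mulmx_diag -diag_const_mx; apply/eqP; congr diag_mx.
by apply/rowP => j; rewrite !mxE; case: ifP; rewrite ?mulrNN mulr1.
Qed.

Definition translation (v : 'cV[R]_n) : rigid_motion :=
  @RigidMotion (1%:M, v) orthogonal1.

Definition glide (i j : 'I_n) : rigid_motion :=
  @RigidMotion (reflection i, 2^-1 *: basis j) (reflection_orthogonal i).

Definition K_generators : set rigid_motion :=
  [set translation (basis i) | i in [set i : 'I_n | i = 0%N :> nat]] `|`
  [set x | exists i j : 'I_n, j = i.+1 :> nat /\ x = glide i j].

Definition K : groupType := generated_group K_generators.

End RigidMotions.

(* the additive group, so * on Z2pow n is + on row vectors *)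
Definition Z2pow (n : nat) : groupType := Algebra.to_multiplicative 'rV['Z_2]_n.

(* Main.v *)
From HB Require Import structures.
Require Import Defs.
From mathcomp Require Import all_boot all_order all_algebra zify.
From mathcomp Require Import boolp classical_sets reals.

(** Up to rescaling, the elements of K are integer vectors.  A translation vector of K
    is an integer along axis 0 and a multiple of one half along the other axes, and
    the linear part reflects axis [i] exactly when the translation along axis [i.+1]
    is an odd multiple of one half.  Doubling all but the first coordinate therefore
    identifies K with the vectors of n integers under the product
    [(v * w) i = v i + (-1) ^ (v i.+1) * w i], the coordinate after the last being 0
    ([K_coordinates]).  Everything else takes place in this model, where [gen i] is
    the unit vector [i]: consecutive generators satisfy
    [gen i.+1 * gen i * gen i.+1 ^-1 = gen i ^-1], the others commute.

    The relations force an endomorphism to be triangular on the generators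
    ([endo_triangular]).  For an automorphism, the diagonal entries [e i] are signs,
    and evaluating the relations again shows that the image of [gen i.+1] has at most
    one further entry, an integer [c i] at [i], which is even for [i > 0]
    ([aut_shape_even], [aut_shape_zero]).  Automorphisms are thus the maps
    [v i |-> e i * v i + (c i if v i.+1 is odd, else 0)] ([aut_signed_shear]), and
    all such data do give automorphisms ([shear_endo_bij]).

    Conjugation by [g] has signs [e i = (-1) ^ (g i.+1)] and shears [c i = 2 * g i]
    ([coord_inner]).  It follows that the n bits: the parity of [c 0]; for
    [0 < j < n - 1], the parity of [c j / 2] plus the sign bit of [e (j - 1)]; the
    sign bit of [e (n - 1)], are invariants of the outer class.  They are additive,
    because signs act trivially modulo 2 on the halved shears ([outer_bitM]); their
    common kernel is the group of inner automorphisms ([outer_bit_trivial_inner]);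
    and they take all values ([outer_bit_surj]). *)

Set Implicit Arguments.
Unset Strict Implicit.
Unset Printing Implicit Defensive.
Import GRing.Theory Num.Theory.
Local Open Scope classical_set_scope.
Local Open Scope group_scope.

(** * The first isomorphism theorem *)

Lemma first_isomorphism (G H : groupType) (N : set G) (nN : normal_subgroup N)
    (f : G -> H) :
  {morph f : x y / x * y} -> (forall y, exists x, f x = y) ->
  (forall x, f x = 1 <-> N x) -> isomorphic (quotient_group nN) H.
Proof.
move=> fM f_surj f_ker.
have f1 : f 1 = 1 by apply: (mulgI (f 1)); rewrite -fM !mulg1.
have fV x : f x^-1 = (f x)^-1 by apply: (mulgI (f x)); rewrite -fM !mulgV.
have f_pi x y : f x = f y <-> N (x^-1 * y).
  split=> [e|xy]; first by apply/f_ker; rewrite fM fV e mulVg.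
  by apply: (mulgI (f x)^-1); rewrite mulVg -fV -fM; apply/esym/f_ker.
pose fbar (q : quotient_group nN) := f (repr q).
have fbarM : {morph fbar : x y / x * y}.
  move=> a b; rewrite /fbar -fM; apply/esym/f_pi.
  exact: (quotient_reprP nN).
pose m := isMultiplicative.Build (quotient_group nN) H fbar fbarM.
pose F : {multiplicative quotient_group nN -> H} := HB.pack fbar m.
exists F; exists (fun y => \pi_(quotient_group nN)%qT (projT1 (cid (f_surj y))))
  => [a|y] /=.
  rewrite -[RHS]reprK; apply/quotient_piP/f_pi.
  by case: cid.
rewrite /fbar -[RHS](projT2 (cid (f_surj y))); apply/esym/f_pi.
exact: quotient_reprP.
Qed.

(** * Integer sequences with a twisted product *)

Section TwistedProduct.
Local Open Scope ring_scope.

Definition oddz (z : int) : bool := ~~ (2 %| z)%Z.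

Lemma oddz0 : oddz 0 = false. Proof. by []. Qed.

Lemma oddzN_if b z : oddz (if b then z else - z) = oddz z.
Proof. by case: b; rewrite /oddz; lia. Qed.

(** The law of K in integer coordinates: the parity of coordinate [i.+1] decides
    whether the linear part reflects axis [i].  Sequences are indexed by all of
    [nat], so that the last axis needs no special case: the coordinate after it is
    0, which is even, and that axis is never reflected. *)
Definition twisted_mul (v w : nat -> int) : nat -> int :=
  fun i => v i + (if oddz (v i.+1) then - w i else w i).

Definition twisted_inv (v : nat -> int) : nat -> int :=
  fun i => if oddz (v i.+1) then v i else - v i.

Definition axis (k : nat) (m : int) : nat -> int :=
  fun i => if i == k then m else 0.

Definition supported (k : nat) (v : nat -> int) : Prop :=
  forall i, (k <= i)%N -> v i = 0.

Lemma supported_twisted_mul k v w : 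
  supported k v -> supported k w -> supported k (twisted_mul v w).
Proof.
by move=> hv hw i ki; rewrite /twisted_mul hv ?hw ?(leqW ki) // oppr0 if_same.
Qed.

(** Splitting off the last coordinate is exact: if [v] is supported below [k.+1],
    the coordinate after [k] vanishes, so [v] is the product of its truncation and
    of a point of axis [k], which is a power of the unit vector. *)
Lemma twisted_generation (P : (nat -> int) -> Prop) k :
  P (fun=> 0) -> (forall v w, P v -> P w -> P (twisted_mul v w)) ->
  (forall v, P v -> P (twisted_inv v)) -> (forall i, (i < k)%N -> P (axis i 1)) ->
  forall v, supported k v -> P v.
Proof.
move=> P0 PM PV.
elim: k => [_ v v0|k IH Px v vk].
  by rewrite (_ : v = fun=> 0) //; apply/funext=> i; rewrite v0.
(* the integer points of axis k, as powers of the unit vector *)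
have PZ : forall m, P (axis k m).
  have Pn : forall m : nat, P (axis k m%:Z).
    elim=> [|m Pm].
      by rewrite (_ : axis k _ = fun=> 0) //; apply/funext=> i; rewrite /axis if_same.
    have := PM _ _ (Px k (leqnn _)) Pm; congr P; apply/funext=> i.
    by rewrite /twisted_mul /axis; do ![case: ifP]; rewrite /oddz; lia.
  case=> m; first exact: Pn.
  have := PV _ (Pn m.+1); congr P; apply/funext=> i.
  by rewrite /twisted_inv /axis; do ![case: ifP]; rewrite /oddz; lia.
have vk0 : supported k (fun i => if i == k then 0 else v i).
  by move=> i ki; case: eqP => // /eqP ik; apply: vk; lia.
have Plow := IH (fun i ik => Px i (leqW ik)) _ vk0.
have := PM _ _ Plow (PZ (v k)); congr P; apply/funext=> i.
rewrite /twisted_mul /axis; case: (eqVneq i k) => [->|_]; last by case: ifP; lia.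
have v0 : v k.+1 = 0 by exact: vk.
by rewrite v0; do ![case: ifP]; rewrite /oddz; lia.
Qed.

(** The general form of an automorphism in coordinates: [e] is the diagonal, and
    [c i] is coordinate [i] of the image of the unit vector [i.+1].  Coordinate [i]
    only sees the parity of [v i.+1], because two copies of that image cancel in
    coordinate [i] by the twist. *)
Definition signed_shear (e c v : nat -> int) : nat -> int :=
  fun i => e i * v i + (if oddz (v i.+1) then c i else 0).

Definition sign_seq (e : nat -> int) : Prop := forall i, e i = 1 \/ e i = -1.

(** The shear into axis 0 may be odd, since no sign is read off coordinate 0; a
    shear into any later axis has to be even in order to keep the signs. *)
Definition even_tail (c : nat -> int) : Prop := forall i, (0 < i)%N -> ~~ oddz (c i).

Lemma oddz_signed_shear e c v i : sign_seq e -> even_tail c ->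
  oddz (signed_shear e c v i.+1) = oddz (v i.+1).
Proof.
move=> he hc; rewrite /signed_shear; have := hc i.+1 isT; case: (he i.+1) => ->;
case: ifP; rewrite /oddz; lia.
Qed.

(** Signs are read off coordinates [i.+1], whose parity is preserved by
    [oddz_signed_shear]; what remains is that parity is a cocycle for the twist:
    [v * w] is odd at [i.+1] iff exactly one of [v], [w] is, and when both are
    the two contributions of [c i] cancel. *)
Lemma signed_shearM e c v w : sign_seq e -> even_tail c ->
  signed_shear e c (twisted_mul v w) =
  twisted_mul (signed_shear e c v) (signed_shear e c w).
Proof.
move=> he hc; apply/funext=> i; rewrite [in RHS]/twisted_mul oddz_signed_shear //.
have oM : oddz (twisted_mul v w i.+1) = oddz (v i.+1) (+) oddz (w i.+1).
  by rewrite /twisted_mul; case: ifP; rewrite /oddz; lia.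
rewrite /signed_shear oM /twisted_mul.
by case: (oddz (v i.+1)); case: (oddz (w i.+1)) => /=; lia.
Qed.

Lemma even_tail_inv e c : sign_seq e -> even_tail c ->
  even_tail (fun i => - (e i * c i)).
Proof.
by move=> he hc i /hc; case: (he i) => ->; rewrite /oddz; lia.
Qed.

Lemma signed_shearK e c v : sign_seq e -> even_tail c ->
  signed_shear e c (signed_shear e (fun i => - (e i * c i)) v) = v.
Proof.
move=> he hc; apply/funext=> i; rewrite {1}/signed_shear oddz_signed_shear //;
  last exact: even_tail_inv.
by rewrite /signed_shear; case: (he i) => ->; case: ifP; lia.
Qed.

Lemma signed_shear_invK e c v : sign_seq e -> even_tail c ->
  signed_shear e (fun i => - (e i * c i)) (signed_shear e c v) = v.
Proof.
move=> he hc; apply/funext=> i; rewrite {1}/signed_shear oddz_signed_shear //.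
by rewrite /signed_shear; case: (he i) => ->; case: ifP; lia.
Qed.

Lemma supported_signed_shear k e c v : supported k v -> supported k (signed_shear e c v).
Proof. by move=> hv i ki; rewrite /signed_shear !hv ?(leqW ki) // mulr0. Qed.
End TwistedProduct.

(** * Groups with twisted coordinates *)

(** Stated through [p] in order not to build the group of sequences supported below
    [n], with the law [twisted_mul], to which [p] is an isomorphism. *)
Record twisted_coordinates (G : groupType) (n : nat) (p : G -> nat -> int) : Prop :=
  TwistedCoordinates {
    coord_inj : injective p;
    coordM : forall g h, p (g * h) = twisted_mul (p g) (p h);
    coord_supp : forall g, supported n (p g);
    coord_surj : forall v, supported n v -> exists g, p g = v }.

Section OuterAutomorphisms.
Variables (G : groupType) (n : nat) (p : G -> nat -> int).
Hypothesis pP : twisted_coordinates n p.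

Let pM g h : p (g * h) = twisted_mul (p g) (p h). Proof. exact: coordM pP g h. Qed.
Let p_supp g : supported n (p g). Proof. exact: coord_supp pP g. Qed.

Lemma coord_eq g h : (forall i, p g i = p h i) -> g = h.
Proof. by move=> gh; exact: (coord_inj pP (funext gh)). Qed.

Lemma coord1 : p 1 = fun=> 0%R.
Proof.
have [g pg] : exists g, p g = fun=> 0%R by exact: (coord_surj pP).
suff -> : 1 = g by [].
apply: (mulgI g); rewrite mulg1; apply: coord_eq => i; rewrite pM pg.
by rewrite /twisted_mul /= addr0.
Qed.

Lemma coordV g : p g^-1 = twisted_inv (p g).
Proof.
have hs : supported n (twisted_inv (p g)).
  by move=> i ni; rewrite /twisted_inv (p_supp g ni) oppr0 if_same.
have [h ph] := coord_surj pP hs.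
suff -> : g^-1 = h by [].
apply: (mulgI g); rewrite mulgV; apply: coord_eq => i; rewrite pM ph coord1.
rewrite /twisted_mul /twisted_inv.
by case: (oddz _); lia.
Qed.

(** Total for convenience, with the junk value 1 on sequences that are not
    supported below [n]. *)
Definition of_coords (v : nat -> int) : G :=
  if pselect (supported n v) is left hv then projT1 (cid (coord_surj pP hv)) else 1.

Lemma coord_of_coords v : supported n v -> p (of_coords v) = v.
Proof.
by rewrite /of_coords; case: pselect => // hv _; case: cid.
Qed.

Definition gen k : G := of_coords (axis k 1).

Lemma coord_gen k : (k < n)%N -> p (gen k) = axis k 1.
Proof.
move=> kn; apply: coord_of_coords => i ni.
by rewrite /axis; case: eqP => // ik; lia.
Qed.

Lemma generation (Q : G -> Prop) k : (k <= n)%N ->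
  Q 1 -> (forall g h, Q g -> Q h -> Q (g * h)) -> (forall g, Q g -> Q g^-1) ->
  (forall i, (i < k)%N -> Q (gen i)) -> forall g, supported k (p g) -> Q g.
Proof.
move=> kn Q1 QM QV Qx g gk.
suff [h [/(coord_inj pP) <-]] : exists h, p h = p g /\ Q h by [].
apply: (@twisted_generation (fun v => exists h, p h = v /\ Q h) k) => //.
- by exists 1; rewrite coord1.
- move=> _ _ [a [<- Qa]] [b [<- Qb]].
  by exists (a * b); rewrite pM; split=> //; exact: QM.
- move=> _ [a [<- Qa]].
  by exists a^-1; rewrite coordV; split=> //; exact: QV.
- move=> i ik; exists (gen i); rewrite coord_gen; first by split=> //; exact: Qx.
  exact: leq_trans kn.
Qed.

(** [gen_comm] and [gen_invert] are the only relations that the analysis of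
    automorphisms uses. *)
Lemma gen_comm i k : (i.+2 <= k < n)%N -> gen i * gen k = gen k * gen i.
Proof.
move=> ikn; apply: coord_eq => j; rewrite !pM !coord_gen; try lia.
by rewrite /twisted_mul /axis; do ![case: eqP => ? /=]; rewrite /oddz; try lia.
Qed.

Lemma gen_invert i : (i.+1 < n)%N -> gen i.+1 * gen i = (gen i)^-1 * gen i.+1.
Proof.
move=> ikn; apply: coord_eq => j; rewrite !pM coordV !coord_gen; try lia.
rewrite /twisted_mul /twisted_inv /axis.
by do ![case: eqP => ? /=]; rewrite /oddz; try lia.
Qed.

(** * Endomorphisms and automorphisms are signed shears *)

Section Endomorphism.
Variable f : G -> G.
Hypothesis fM : {morph f : x y / x * y}.

Let f1 : f 1 = 1.
Proof. by apply: (mulgI (f 1)); rewrite -fM !mulg1. Qed.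

Let fV g : f g^-1 = (f g)^-1.
Proof. by apply: (mulgI (f g)); rewrite -fM !mulgV. Qed.

(** The flag of subgroups supported below [k] is preserved.  Descending induction on
    [k]: on the subgroup supported below [k.+1], coordinate [k] is a homomorphism to
    the integers, and for [j < k] the generator [gen j] is conjugate to its inverse
    inside that subgroup, so its image has coordinate [k] equal to its opposite. *)
Lemma endo_triangular i : (i < n)%N -> supported i.+1 (p (f (gen i))).
Proof.
suff H : forall d k, (k + d = n)%N -> forall j, (j < k)%N -> supported k (p (f (gen j))).
  by move=> i_n; apply: (H (n - i.+1)%N) => //; lia.
elim=> [|d IH] k kdn j jk.
  by rewrite (_ : k = n); [exact: p_supp | lia].
have hj := IH k.+1 ltac:(lia) j ltac:(lia).
have hj1 := IH k.+1 ltac:(lia) j.+1 ltac:(lia).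
move=> l; rewrite leq_eqVlt => /orP[/eqP<-|]; last exact: hj.
have /(congr1 (fun g => p (f g) k)) := gen_invert (i := j) ltac:(lia).
rewrite !fM fV !pM coordV /twisted_mul /twisted_inv (hj _ (leqnn _)) (hj1 _ (leqnn _)).
rewrite oppr0 if_same oddz0; lia.
Qed.

(** Both sides are homomorphisms to the integers on the subgroup supported below
    [k.+1], and they agree on its generators. *)
Lemma endo_diagonal k g : (k < n)%N -> supported k.+1 (p g) ->
  p (f g) k = (p (f (gen k)) k * p g k)%R.
Proof.
move=> kn gk.
pose Q g := [/\ supported k.+1 (p g), supported k.+1 (p (f g)) &
  p (f g) k = (p (f (gen k)) k * p g k)%R].
suff [] : Q g by [].
apply: (@generation Q k.+1) => //.
- by rewrite /Q f1 coord1 mulr0.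
- move=> a b [a1 a2 a3] [b1 b2 b3]; split.
  + by rewrite pM; exact: supported_twisted_mul.
  + by rewrite fM pM; exact: supported_twisted_mul.
  + by rewrite fM !pM /twisted_mul a3 b3 (a1 _ (leqnn _)) (a2 _ (leqnn _)) oddz0 mulrDr.
- move=> a [a1 a2 a3]; split.
  + by rewrite coordV => i ki; rewrite /twisted_inv (a1 _ ki) oppr0 if_same.
  + by rewrite fV coordV => i ki; rewrite /twisted_inv (a2 _ ki) oppr0 if_same.
  + by rewrite fV !coordV /twisted_inv a3 (a1 _ (leqnn _)) (a2 _ (leqnn _)) oddz0 mulrN.
- move=> i ik; split.
  + by rewrite coord_gen => [j kj|]; rewrite ?/axis; [case: eqP => //|]; lia.
  + by move=> j kj; apply: (@endo_triangular i); lia.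
  + rewrite coord_gen; last lia.
    have [->|ik'] := eqVneq i k; first by rewrite /axis eqxx mulr1.
    rewrite /axis eq_sym (negPf ik') mulr0.
    by apply: (@endo_triangular i); lia.
Qed.

Lemma endo_ext (h : G -> G) : {morph h : x y / x * y} ->
  (forall i, (i < n)%N -> f (gen i) = h (gen i)) -> f =1 h.
Proof.
move=> hM e g.
have h1 : h 1 = 1 by apply: (mulgI (h 1)); rewrite -hM !mulg1.
have hV x : h x^-1 = (h x)^-1 by apply: (mulgI (h x)); rewrite -hM !mulgV.
apply: (@generation (fun g => f g = h g) n) => //.
- by rewrite f1 h1.
- by move=> a b; rewrite fM hM => -> ->.
- by move=> a; rewrite fV hV => ->.
Qed.

Hypothesis diag1 : forall k, (k < n)%N ->
  p (f (gen k)) k = 1%R \/ p (f (gen k)) k = (-1)%R.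

(** Apply the relation [gen_comm] in coordinate [i]: the image of [gen i] has an odd
    entry there and nothing further, so it commutes with the image of [gen k] only if
    the latter does not reflect axis [i], that is, if it is even at [i.+1]. *)
Lemma aut_shape_even i k : (i.+2 <= k < n)%N -> ~~ oddz (p (f (gen k)) i.+1).
Proof.
move=> ikn; have /(congr1 (fun g => p (f g) i)) := gen_comm ikn.
rewrite !fM !pM /twisted_mul (endo_triangular (i := i) _ (leqnn _)); last lia.
rewrite oddz0; case: ifP => // _.
by have := diag1 (k := i) ltac:(lia); lia.
Qed.

(** Coordinate [i] of the relation between [gen i.+1] and [gen k].  The image of
    [gen i.+1] is odd at [i.+1], hence reflects axis [i], whereas the image of
    [gen k] does not, by [aut_shape_even]; this forces the entry to vanish, whether
    the two generators commute or one inverts the other. *)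
Lemma aut_shape_zero i k : (i.+2 <= k < n)%N -> p (f (gen k)) i = 0%R.
Proof.
move=> ikn; have ev := aut_shape_even ikn.
have od : oddz (p (f (gen i.+1)) i.+1).
  by have [->|->] := diag1 (k := i.+1) ltac:(lia).
have [ik|ik] := eqVneq k i.+2.
  have /(congr1 (fun g => p (f g) i)) := gen_invert (i := i.+1) ltac:(lia).
  rewrite -ik !fM fV !pM coordV /twisted_mul /twisted_inv (negPf ev) oddzN_if od; lia.
have /(congr1 (fun g => p (f g) i)) := gen_comm (i := i.+1) (k := k) ltac:(lia).
by rewrite !fM !pM /twisted_mul od (negPf ev); lia.
Qed.
End Endomorphism.

(** The defaults outside the range make [diag_sign] a sign everywhere and [shear]
    even beyond 0, so that they can be fed to [signed_shear] without bounds. *)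
Definition diag_sign (f : G -> G) (i : nat) : int :=
  if (i < n)%N then p (f (gen i)) i else 1%R.
Definition shear (f : G -> G) (i : nat) : int :=
  if (i.+1 < n)%N then p (f (gen i.+1)) i else 0%R.

(** The inverse automorphism is triangular too, so [endo_diagonal] at the inverse
    image of [gen i] exhibits the diagonal entry as a divisor of 1. *)
Lemma sign_seq_diag_sign (f : Aut G) : sign_seq (diag_sign f).
Proof.
move=> i; rewrite /diag_sign; case: ifP => [i_n|_]; last by left.
have fiM := autM (aut_inv f).
have := endo_diagonal (autM f) i_n (endo_triangular fiM i_n).
rewrite /= aut_inv_funK coord_gen // /axis eqxx.
move/(congr1 absz)/esym/eqP; rewrite abszM muln_eq1 => /andP[/eqP + _].
by set a := p _ _; lia.
Qed.

Lemma aut_diagonal (f : Aut G) k : (k < n)%N ->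
  p (f (gen k)) k = 1%R \/ p (f (gen k)) k = (-1)%R.
Proof. by move=> kn; have := sign_seq_diag_sign f k; rewrite /diag_sign kn. Qed.

Lemma even_tail_shear (f : Aut G) : even_tail (shear f).
Proof.
case=> // i _; rewrite /shear; case: ifP => // i_n.
by apply: (aut_shape_even (autM f) (@aut_diagonal f)); lia.
Qed.

Definition shear_endo (e c : nat -> int) (g : G) : G :=
  of_coords (signed_shear e c (p g)).

Lemma coord_shear_endo e c g : p (shear_endo e c g) = signed_shear e c (p g).
Proof. by apply/coord_of_coords/supported_signed_shear. Qed.

Lemma shear_endoM e c : sign_seq e -> even_tail c ->
  {morph shear_endo e c : x y / x * y}.
Proof.
move=> he hc x y; apply: coord_eq => i.
by rewrite pM !coord_shear_endo pM signed_shearM.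
Qed.

(** Both sides are endomorphisms, so it is enough to compare them on generators,
    where the triangular shape, [aut_shape_zero] and the definitions give every
    entry. *)
Lemma aut_signed_shear (f : Aut G) g :
  p (f g) = signed_shear (diag_sign f) (shear f) (p g).
Proof.
have he := sign_seq_diag_sign f; have hc := even_tail_shear f.
rewrite (endo_ext (autM f) (shear_endoM he hc)) ?coord_shear_endo // => k kn.
apply: coord_eq => i; rewrite coord_shear_endo coord_gen // /signed_shear /axis.
have [->|ik] := eqVneq i k.
  by rewrite gtn_eqF // oddz0 /diag_sign kn mulr1 addr0.
rewrite mulr0 add0r; have [ik1|ik1] := eqVneq i.+1 k.
  by rewrite /shear ik1 kn.
have [ki|ki] := ltnP k i; first exact: (endo_triangular (autM f) kn).
by apply: (aut_shape_zero (autM f) (@aut_diagonal f)); lia.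
Qed.

Lemma shear_endo_bij e c : sign_seq e -> even_tail c -> bijective (shear_endo e c).
Proof.
move=> he hc; exists (shear_endo e (fun i => - (e i * c i))%R) => g;
  apply: coord_eq => i; rewrite !coord_shear_endo.
- by rewrite signed_shear_invK.
- by rewrite signed_shearK.
Qed.

Lemma shear_aut_subproof e c (he : sign_seq e) (hc : even_tail c) :
  is_automorphism (shear_endo e c).
Proof. by apply/asboolP; split; [exact: shear_endoM|exact: shear_endo_bij]. Qed.

Definition shear_aut e c he hc : Aut G := Automorphism (@shear_aut_subproof e c he hc).

Lemma diag_sign_signed_shear f e c : (forall g, p (f g) = signed_shear e c (p g)) ->
  forall i, (i < n)%N -> diag_sign f i = e i.
Proof.
move=> fE i i_n; rewrite /diag_sign i_n fE coord_gen // /signed_shear /axis eqxx.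
by rewrite gtn_eqF // mulr1 addr0.
Qed.

Lemma shear_signed_shear f e c : (forall g, p (f g) = signed_shear e c (p g)) ->
  forall i, (i.+1 < n)%N -> shear f i = c i.
Proof.
move=> fE i i_n; rewrite /shear i_n fE coord_gen // /signed_shear /axis eqxx.
by rewrite ltn_eqF // mulr0 add0r.
Qed.

Lemma diag_signM (f h : Aut G) i : (i < n)%N ->
  diag_sign (f * h) i = (diag_sign f i * diag_sign h i)%R.
Proof.
move=> i_n; rewrite [LHS]/diag_sign i_n /= aut_signed_shear /signed_shear.
by rewrite (endo_triangular (autM h) i_n (leqnn _)) /= addr0
  [diag_sign h i]/diag_sign i_n.
Qed.

(** The diagonal of [h] is odd, so the shear of [f] always contributes. *)
Lemma shearM (f h : Aut G) i : (i.+1 < n)%N ->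
  shear (f * h) i = (diag_sign f i * shear h i + shear f i)%R.
Proof.
move=> i_n; rewrite [LHS]/shear i_n /= aut_signed_shear {1}/signed_shear.
rewrite [shear h i]/shear i_n.
by have [->|->] := aut_diagonal h i_n.
Qed.

(** Conjugation by [g] is the signed shear with signs [(-1) ^ (p g i.+1)] and shears
    [2 * p g i]: a single coordinate of [g] controls both the sign at [i.-1] and
    the shear at [i]. *)
Lemma coord_inner g h : p (inner g h) =
  signed_shear (fun i => if oddz (p g i.+1) then -1 else 1)%R
    (fun i => p g i + p g i)%R (p h).
Proof.
apply/funext=> i; rewrite /= !pM coordV /twisted_mul /signed_shear /twisted_inv.
have oM : oddz (p g i.+1 + (if oddz (p g i.+2) then - p h i.+1 else p h i.+1))%R =
    oddz (p g i.+1) (+) oddz (p h i.+1).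
  by case: ifP; rewrite /oddz; lia.
by rewrite oM; case: (oddz (p g i.+1)); case: (oddz (p h i.+1)) => /=; lia.
Qed.

Lemma aut_ext_signed_shear (f h : Aut G) :
  (forall i, (i < n)%N -> diag_sign f i = diag_sign h i) ->
  (forall i, (i.+1 < n)%N -> shear f i = shear h i) -> f = h.
Proof.
move=> he hc.
have eE : diag_sign f = diag_sign h.
  apply/funext=> i; have [i_n|ni] := ltnP i n; first exact: he.
  by rewrite /diag_sign ltnNge ni.
have sE : shear f = shear h.
  apply/funext=> i; have [i_n|ni] := ltnP i.+1 n; first exact: hc.
  by rewrite /shear ltnNge ni.
by apply: aut_eqP => g; apply: coord_eq => i; rewrite !aut_signed_shear eE sE.
Qed.

(** * The invariants of outer automorphisms *)

Hypothesis n_ge2 : (2 <= n)%N.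

(** The class of an automorphism modulo inner ones.  By [coord_inner], conjugation by
    [g] shifts half the shear at [j] by [p g j] and multiplies the sign at [j.-1] by
    the parity of the same number, so their combination is invariant; at the two
    ends of the chain, the parity of the shear at 0 and the last sign cannot be
    changed by inner automorphisms at all. *)
Definition outer_bit (f : Aut G) (j : nat) : bool :=
  if j == 0%N then oddz (shear f 0)
  else if j == n.-1 then diag_sign f n.-1 == (-1)%R
  else oddz (shear f j %/ 2)%Z (+) (diag_sign f j.-1 == (-1)%R).

(** Shears compose by [shearM], and multiplying an even shear by a sign does not
    change its half modulo 2. *)
Lemma outer_bitM f h j : (j < n)%N ->
  outer_bit (f * h) j = outer_bit f j (+) outer_bit h j.
Proof.
move=> jn; rewrite /outer_bit; case: eqP => [_|/eqP j0].
  rewrite shearM; last lia.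
  by case: (sign_seq_diag_sign f 0) => ->; rewrite /oddz; lia.
case: eqP => [_|/eqP jn1].
  rewrite diag_signM; last lia.
  by case: (sign_seq_diag_sign f n.-1) => ->; case: (sign_seq_diag_sign h n.-1) => ->.
rewrite diag_signM ?shearM; [|lia..].
have := even_tail_shear f (i := j); have := even_tail_shear h (i := j).
case: (sign_seq_diag_sign f j) => ->; case: (sign_seq_diag_sign f j.-1) => ->;
  case: (sign_seq_diag_sign h j.-1) => ->; rewrite /oddz /=; lia.
Qed.

Lemma outer_bit_inner g j : (j < n)%N -> outer_bit (inner g) j = false.
Proof.
move=> jn; rewrite /outer_bit.
have eI := diag_sign_signed_shear (coord_inner g).
have sI := shear_signed_shear (coord_inner g).
case: eqP => [_|/eqP j0]; first by rewrite sI /oddz; lia.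
case: eqP => [_|/eqP jn1].
  by rewrite eI ?prednK ?(coord_supp pP) //; lia.
rewrite eI ?sI; [|lia..]; rewrite prednK; last lia.
by case: ifP; rewrite /oddz; lia.
Qed.

(** The conjugating element is read off [coord_inner]: its coordinates are half the
    shears of [f], except the last one, which no shear determines and which is
    chosen to produce the sign at [n.-2].  The vanishing of the bits says that the
    signs below are then correct. *)
Lemma outer_bit_trivial_inner f : (forall j, (j < n)%N -> outer_bit f j = false) -> Inn f.
Proof.
move=> f0.
pose v i : int := if (i.+1 < n)%N then (shear f i %/ 2)%Z
  else if (i.+1 == n) && (diag_sign f n.-2 == (-1)%R) then 1%R else 0%R.
have vn : supported n v by move=> i ni; rewrite /v !ifF //; lia.
exists (of_coords v) => //.
have eI := diag_sign_signed_shear (coord_inner (of_coords v)).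
have sI := shear_signed_shear (coord_inner (of_coords v)).
apply: aut_ext_signed_shear => i i_n; rewrite ?eI ?sI // coord_of_coords //.
  have [ik|ik] := eqVneq i n.-1.
    rewrite vn; last lia.
    have := f0 n.-1 ltac:(lia); rewrite /outer_bit ifF ?eqxx -?ik; last lia.
    by case: (sign_seq_diag_sign f i) => ->.
  have [ik2|ik2] := eqVneq i n.-2.
    have -> : v i.+1 = if diag_sign f i == (-1)%R then 1%R else 0%R.
      rewrite /v -ik2 ifF; last lia.
      by rewrite (_ : i.+2 == n); last lia.
    by case: (sign_seq_diag_sign f i) => ->.
  have := f0 i.+1 ltac:(lia); rewrite /outer_bit /= ifF; last lia.
  have -> : v i.+1 = (shear f i.+1 %/ 2)%Z by rewrite /v ifT //; lia.
  by case: (sign_seq_diag_sign f i) => ->; case: (oddz _).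
rewrite /v i_n; case: i i_n => [|i] i_n.
  by have := f0 0%N ltac:(lia); rewrite /outer_bit /= /oddz; lia.
by have := even_tail_shear f (i := i.+1) isT; rewrite /oddz; lia.
Qed.

(** Shears beyond 0 are taken to be 0, so that bit [j] becomes the sign at [j.-1] for
    the middle indices; bit [n.-1] is the sign at [n.-1].  The truncated index in
    [e] serves both cases, the sign at [n.-2] being arbitrary. *)
Lemma outer_bit_surj (b : nat -> bool) :
  exists f, forall j, (j < n)%N -> outer_bit f j = b j.
Proof.
pose e (i : nat) : int := if b (minn i.+1 n.-1) then (-1)%R else 1%R.
pose c (i : nat) : int := if (i == 0%N) && b 0%N then 1%R else 0%R.
have he : sign_seq e by move=> i; rewrite /e; case: ifP => _; [right|left].
have hc : even_tail c by case.
exists (shear_aut he hc) => j jn.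
have eI : forall i, (i < n)%N -> diag_sign (shear_aut he hc) i = e i.
  exact: diag_sign_signed_shear (coord_shear_endo e c).
have sI : forall i, (i.+1 < n)%N -> shear (shear_aut he hc) i = c i.
  exact: shear_signed_shear (coord_shear_endo e c).
rewrite /outer_bit; have [->|j0] := eqVneq j 0%N.
  by rewrite sI // /c eqxx /=; case: (b 0%N).
have [->|jn1] := eqVneq j n.-1.
  rewrite eI; last lia.
  by rewrite /e (_ : minn n.-1.+1 n.-1 = n.-1); [case: (b _)|lia].
rewrite eI ?sI; [|lia..].
rewrite /c (negPf j0) /= /e (_ : minn j.-1.+1 n.-1 = j); [by case: (b j)|lia].
Qed.

Local Notation bit b := ((nat_of_bool b)%:R : 'Z_2)%R.

Definition outer_vec (f : Aut G) : Z2pow n := (\row_j bit (outer_bit f j))%R.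

Theorem Out_twisted : isomorphic (Out G) (Z2pow n).
Proof.
apply: (@first_isomorphism _ _ _ _ outer_vec).
- move=> f h; apply/rowP => j; rewrite !mxE outer_bitM //.
  by case: (outer_bit f j); case: (outer_bit h j); apply/val_inj.
- move=> y; have [f fy] := outer_bit_surj
    (fun j => if insub j is Some j' then y ord0 j' != 0%R else false).
  exists f; apply/rowP => j; rewrite mxE fy // valK.
  by case: (y ord0 j) => [[|[|]]] //= ?; apply/val_inj.
- move=> f; split=> [f0|[g _ <-]].
    apply: outer_bit_trivial_inner => j jn.
    have /rowP/(_ (Ordinal jn)) := f0; rewrite !mxE /=.
    by case: (outer_bit f j).
  by apply/rowP => j; rewrite !mxE outer_bit_inner.
Qed.
End OuterAutomorphisms.

(** * Integer coordinates on K *)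

Section MotionCoordinates.
Variables (R : realType) (n : nat).
Local Open Scope ring_scope.

(** Translations of K are integers along axis 0 and multiples of one half along the
    other axes. *)
Definition scale (i : nat) : R := if i == 0%N then 1 else 2^-1.

(** The linear part of an element of K is determined by its translation: a glide
    reflecting axis [i] moves axis [i.+1] by one half. *)
Definition sign_mx (v : nat -> int) : 'M[R]_n :=
  diag_mx (\row_i (-1) ^+ oddz (v i.+1)).

Lemma sign_mx_orthogonal v : Defs.orthogonal (sign_mx v).
Proof.
rewrite /Defs.orthogonal tr_diag_mx mulmx_diag -diag_const_mx; apply/eqP; congr diag_mx.
by apply/rowP => j; rewrite !mxE -expr2 sqrr_sign.
Qed.

Definition motion (v : nat -> int) : rigid_motion R n :=
  @RigidMotion _ _ (sign_mx v, \col_i (scale i * (v i)%:~R)) (sign_mx_orthogonal v).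

Lemma motion_eq (u w : rigid_motion R n) : u.1 = w.1 -> u.2 = w.2 -> u = w.
Proof.
by case: u w => [[A a] ?] [[B b] ?] /= e1 e2; apply: val_inj; rewrite /= e1 e2.
Qed.

Lemma motionM v w : motion (twisted_mul v w) = (motion v * motion w)%g.
Proof.
apply: motion_eq => /=.
  rewrite /sign_mx mulmx_diag; congr diag_mx; apply/rowP => i; rewrite !mxE.
  rewrite -signr_addb; congr (_ ^+ _); congr nat_of_bool.
  by rewrite /twisted_mul; case: ifP; rewrite /oddz; lia.
apply/colP => i; rewrite mul_diag_mx !mxE /twisted_mul mulr_sign.
by case: (oddz _); rewrite rmorphD ?rmorphN /= mulrDr addrC ?mulrN.
Qed.

Lemma motion0 : motion (fun=> 0) = 1%g.
Proof.
apply: motion_eq => /=.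
  by rewrite -diag_const_mx; congr diag_mx; apply/rowP => i; rewrite !mxE.
by apply/colP => i; rewrite !mxE mulr0.
Qed.

Lemma motionV v : motion (twisted_inv v) = (motion v)^-1%g.
Proof.
apply: (mulgI (motion v)); rewrite mulgV -motionM -motion0; congr motion.
by apply/funext=> i; rewrite /twisted_mul /twisted_inv; case: (oddz _); lia.
Qed.

Lemma motion_inj v w : supported n v -> supported n w -> motion v = motion w -> v = w.
Proof.
move=> hv hw vw; apply/funext=> i.
have [ni|i_n] := leqP n i; first by rewrite hv ?hw.
have /colP/(_ (Ordinal i_n)) : (motion v).2 = (motion w).2 by rewrite vw.
rewrite !mxE /= => /mulfI e; apply/eqP; rewrite -(eqr_int R); apply/eqP/e.
by rewrite /scale; case: (i == 0%N); rewrite ?oner_eq0 ?invr_eq0 ?pnatr_eq0.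
Qed.

Lemma motion_axis0 (i : 'I_n) : i = 0%N :> nat ->
  motion (axis 0 1) = translation (basis R i).
Proof.
move=> i0; apply: motion_eq => /=.
  by rewrite -diag_const_mx; congr diag_mx; apply/rowP => j; rewrite !mxE.
apply/colP => j; rewrite !mxE eqxx andbT -val_eqE /= i0 /scale /axis /=.
by case: (_ == _); rewrite ?mul1r ?mulr0.
Qed.

Lemma motion_axisS (i j : 'I_n) : j = i.+1 :> nat -> motion (axis j 1) = glide R i j.
Proof.
move=> ji; apply: motion_eq => /=.
  congr diag_mx; apply/rowP => k; rewrite !mxE -val_eqE /= /axis ji eqSS.
  by case: (_ == _).
apply/colP => k; rewrite !mxE eqxx andbT -val_eqE /axis /=.
case: eqP => [->|_]; last by rewrite !mulr0.
by rewrite /scale ji.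
Qed.

Lemma mem_generated (S : set (rigid_motion R n)) x : S x -> generated S x.
Proof. by move=> Sx H _; apply. Qed.

(** The motions of the unit vectors are exactly the generators of K, so
    [twisted_generation] applies. *)
Lemma motion_in_K v : supported n v -> generated (@K_generators R n) (motion v).
Proof.
have [K1 KM KV] := subgroup_generated (@K_generators R n).
apply: (twisted_generation (P := fun v => generated (@K_generators R n) (motion v))).
- by rewrite motion0.
- by move=> u w Ku Kw; rewrite motionM; exact: KM.
- by move=> u Ku; rewrite motionV; exact: KV.
- move=> [|i] i_n; apply: mem_generated.
    by left; exists (Ordinal i_n) => //; rewrite (motion_axis0 (i := Ordinal i_n)).
  right; exists (Ordinal (ltnW i_n)), (Ordinal i_n); split=> //.
  exact: (motion_axisS (i := Ordinal (ltnW i_n)) (j := Ordinal i_n)).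
Qed.

(** The motions of supported sequences form a subgroup that contains the
    generators. *)
Lemma K_motion (g : K R n) : exists v, supported n v /\ motion v = gen_val g.
Proof.
have : generated (@K_generators R n) (gen_val g).
  by case: g => g /=; rewrite /in_generated inE.
move=> /(_ [set x | exists v, supported n v /\ motion v = x]); apply.
  split=> [|_ _ [v [hv <-]] [w [hw <-]]|_ [v [hv <-]]].
  - by exists (fun=> 0); rewrite motion0.
  - by exists (twisted_mul v w); rewrite motionM; split=> //;
      exact: supported_twisted_mul.
  - exists (twisted_inv v); rewrite motionV; split=> // i ni.
    by rewrite /twisted_inv (hv _ ni) oppr0 if_same.
have ax i : (i < n)%N -> supported n (axis i 1).
  by move=> i_n k nk; rewrite /axis; case: eqP => // ki; lia.
move=> x [[i i0 <-]|[i [j [ji ->]]]].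
  by exists (axis 0 1); rewrite (motion_axis0 i0); split=> //; apply: ax;
    have := ltn_ord i; lia.
by exists (axis j 1); rewrite (motion_axisS ji); split=> //; exact: ax.
Qed.

Lemma K_coordinates : exists p : K R n -> nat -> int, twisted_coordinates n p.
Proof.
pose p g := projT1 (cid (K_motion g)).
have pP g : supported n (p g) /\ motion (p g) = gen_val g.
  by rewrite /p; case: cid.
exists p; split.
- by move=> g h gh; apply/val_inj; rewrite /= -(pP g).2 -(pP h).2 gh.
- move=> g h; apply: motion_inj; first exact: (pP _).1.
    by apply: supported_twisted_mul; exact: (pP _).1.
  by rewrite motionM !(pP _).2.
- by move=> g; exact: (pP g).1.
- move=> v hv; have Kv : in_generated (@K_generators R n) (motion v).
    by rewrite /in_generated inE; exact: motion_in_K.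
  exists (GeneratedGroup Kv); apply: motion_inj => //; first exact: (pP _).1.
  by rewrite (pP _).2.
Qed.
End MotionCoordinates.

Theorem corollary7p2 (R : realType) (n : nat) (hn : (2 <= n)%N) :
  isomorphic (Out (K R n)) (Z2pow n).
Proof.
by have [p pP] := K_coordinates R n; exact: Out_twisted pP hn.
Qed.
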